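(* Let $S:H\to H$ be the antipode of the output feedback Hopf algebra $H$. For any nonempty word $\eta=x_{i_1}\cdots x_{i_l}\in X^*$, $$Sa_\eta=(-1)^{|\eta|-1}\,\tilde\Theta'_\eta(a_\emptyset),$$ where $|\eta|=l$ is the length of $\eta$ and $$\tilde\Theta'_\eta:=\tilde\theta'_{i_l}\circ\cdots\circ\tilde\theta'_{i_1},$$ with $\tilde\theta'_0,\tilde\theta'_1$ the derivations of the algebra $H$ given on coordinate functions by $$\tilde\theta'_1(a_\eta):=-a_{\eta x_1},\qquad \tilde\theta'_0(a_\eta):=-\tilde\theta_0(a_\eta)+a_\emptyset\tilde\theta_1(a_\eta)=-a_{\eta x_0}+a_{\eta x_1}a_\emptyset .$$
   Context: Words and series. $X=\{x_0,x_1\}$ is an alphabet of two noncommuting letters, $X^*$ the set of all words over $X$ including the empty word $\emptyset$, and $\mathbb{R}\langle\langle X\rangle\rangle$ the set of formal series $c=\sum_{\eta\in X^*}\langle c,\eta\rangle\eta$ with real coefficients; $\mathbf 1=1\emptyset$. For $\eta\in X^*$, $|\eta|_{x_i}$ is the number of occurrences of $x_i$ in $\eta$, and $\deg(\eta)=2|\eta|_{x_0}+|\eta|_{x_1}+1$. Shuffle product. $\sqcup\!\sqcup$ is the bilinear product determined by $\emptyset\sqcup\!\sqcup\,\eta=\eta\sqcup\!\sqcup\,\emptyset=\eta$ and $x_i\eta\sqcup\!\sqcup\, x_j\nu=x_i(\eta\sqcup\!\sqcup\, x_j\nu)+x_j(x_i\eta\sqcup\!\sqcup\,\nu)$, extended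 to series. Modified composition product. For $c,d\in\mathbb{R}\langle\langle X\rangle\rangle$, $c\,\tilde\circ\,d=\sum_{\eta\in X^*}\langle c,\eta\rangle\,\phi_d(\eta)(\mathbf 1)$, where $\phi_d(\emptyset)=id$, $\phi_d(x_{i_1}\cdots x_{i_k})=\phi_d(x_{i_1})\circ\cdots\circ\phi_d(x_{i_k})$, $\phi_d(x_0)(e)=x_0e$, $\phi_d(x_1)(e)=x_1e+x_0(d\sqcup\!\sqcup\, e)$ for $e\in\mathbb{R}\langle\langle X\rangle\rangle$. Output feedback Hopf algebra. $H$ is the free unital commutative $\mathbb{R}$-algebra (unit $\mathbf 1$) on generators $a_\eta$, $\eta\in X^*$ (coordinate functions). An element of $H$ is evaluated at a series $c$ by the unital algebra morphism with $a_\eta(c)=\langle c,\eta\rangle$. The counit satisfies $\varepsilon(a_\eta)=0$, and the coproduct $\Delta$ is the algebra morphism with $\Delta a_\eta=\tilde\Delta a_\eta+\mathbf 1\otimes a_\eta$, where $\tilde\Delta a_\eta=\sum a_{\eta(1)}\otimes a_{\eta(2)}\in H\otimes H$ is the element such that $\sum a_{\eta(1)}(c)\,a_{\eta(2)}(d)=\langle c\,\tilde\circ\,d,\eta\rangle$ for all series $c,d$. It is known that $H$ is a connected graded commutative Hopf algebra with $\deg(a_\eta)=\deg(\eta)$; its antipode $S$ is the inverse of the identity of $H$ for the convolution product. Right-augmentation operators. $\tilde\theta_i$ ($i=0,1$) is the derivation of the algebra $H$ with $\tilde\theta_i(a_\eta)=a_{\eta x_i}$ (so $\tilde\theta_i(\mathbf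 1)=0$). *)

(* Defs.v *)
From HB Require Import structures.
From mathcomp Require Import all_boot all_order all_algebra.
From mathcomp Require Import finmap.
From mathcomp Require Import reals.
From mathcomp.multinomials Require Import monalg.

Set Implicit Arguments.
Unset Strict Implicit.
Unset Printing Implicit Defensive.

Import GRing.Theory.
Local Open Scope ring_scope.

(** * Words and series *)

(* The letter x_i is encoded by the boolean i. *)
Notation letter := bool.
Notation word := (seq bool).
Notation x0 := false (only parsing).
Notation x1 := true (only parsing).

Fixpoint words (n : nat) : seq word :=
  if n is n'.+1 then [seq i :: w | i <- [:: x0; x1], w <- words n'] else [:: [::]].

Definition words_upto (n : nat) : seq word :=
  flatten [seq words k | k <- iota 0 n.+1].

Lemma mem_words n w : (w \in words n) = (size w == n).
Proof.
elim: n w => [|n IH] [|i w] //=; first by rewrite mem_cat mem_cat; apply/negP;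
  case/or3P=> [/mapP[]|/mapP[]|].
rewrite cats0 mem_cat eqSS -IH.
case: i; last first.
  rewrite mem_map; last by move=> ? ? [].
  by case: (w \in _) => //=; apply/negP => /mapP[].
rewrite orbC mem_map; last by move=> ? ? [].
by case: (w \in _) => //=; apply/negP => /mapP[].
Qed.

Lemma uniq_words n : uniq (words n).
Proof.
elim: n => //= n IH; rewrite cats0 cat_uniq !map_inj_uniq ?IH //=;
  try by move=> ? ? [].
by rewrite andbT; apply/hasPn => _ /mapP[w _ ->]; apply/negP => /mapP[].
Qed.

Lemma mem_words_upto n w : (w \in words_upto n) = (size w <= n)%N.
Proof.
apply/flatten_mapP/idP => [[k]|h].
  by rewrite mem_iota mem_words add0n ltnS => /andP[_ hk] /eqP ->.
by exists (size w); rewrite ?mem_iota ?mem_words.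
Qed.

Lemma uniq_words_upto n : uniq (words_upto n).
Proof.
rewrite /words_upto; elim: n.+1 => // m IH.
rewrite -addn1 iotaD map_cat flatten_cat cat_uniq IH /= cats0 uniq_words andbT.
apply/hasPn => w; rewrite mem_words => /eqP hw.
apply/negP => /flatten_mapP[k]; rewrite mem_iota mem_words hw.
by move=> /andP[_ hk] /eqP E; rewrite -E ltnn in hk.
Qed.

(* The shuffle product of two words, as the list (with multiplicities) of the
   words occurring in it. *)
Fixpoint shuffle_words (u : word) : word -> seq word :=
  if u is i :: u' then
    fix shuffle_u (v : word) : seq word :=
      if v is j :: v' then
        [seq i :: w | w <- shuffle_words u' v] ++ [seq j :: w | w <- shuffle_u v']
      else [:: u]
  else fun v => [:: v].

Lemma size_shuffle_words u v w :
  w \in shuffle_words u v -> size w = (size u + size v)%N.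
Proof.
elim: u v w => [|i u IHu] v w /=; first by rewrite inE => /eqP ->.
elim: v w => [|j v IHv] w /=; first by rewrite inE addn0 => /eqP ->.
rewrite mem_cat => /orP[] /mapP[z hz ->] /=; first by rewrite (IHu _ _ hz).
by rewrite (IHv _ hz) !addnS.
Qed.

Section Series.
Variable A : comNzRingType.

(* [c w] is the coefficient <c, w>. *)
Definition series := word -> A.

Definition series1 : series := fun w => (w == [::])%:R.

Definition lcat (i : letter) (e : series) : series :=
  fun w => if w is j :: w' then if j == i then e w' else 0 else 0.

Definition series_add (c d : series) : series := fun w => c w + d w.

(* Longer words [u] or [v] do not contribute to the coefficient of [w]:
   see [size_shuffle_words]. *)
Definition shuffle (c d : series) : series := fun w =>
  \sum_(u <- words_upto (size w)) \sum_(v <- words_upto (size w))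
    (c u * d v) *+ count_mem w (shuffle_words u v).

Definition phi_letter (d : series) (i : letter) (e : series) : series :=
  if i then series_add (lcat x1 e) (lcat x0 (shuffle d e)) else lcat x0 e.

Fixpoint phi (d : series) (w : word) (e : series) : series :=
  if w is i :: w' then phi_letter d i (phi d w' e) else e.

(* The modified composition product. Words [v] longer than [w] do not
   contribute to the coefficient of [w]: see [phi_small]. *)
Definition mcomp (c d : series) : series := fun w =>
  \sum_(v <- words_upto (size w)) c v * phi d v series1 w.

Lemma phi_small d v w : (size w < size v)%N -> phi d v series1 w = 0.
Proof.
elim: v w => //= i v IH w hw; rewrite /phi_letter.
have L j : lcat j (phi d v series1) w = 0.
  by case: w hw => //= k w hw; case: eqP => // _; apply: IH.
case: i => //; rewrite /series_add L add0r.
case: w hw {L} => //= k w hw; case: eqP => // _.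
rewrite /shuffle big1_seq // => u _; rewrite big1_seq // => z.
rewrite mem_words_upto => /andP[_ hz].
by rewrite IH ?mulr0 ?mul0rn //; apply: leq_ltn_trans hz _.
Qed.

End Series.

(** * The tensor square of a monoid algebra

    The monoid algebra of [M * M] is the tensor square of the monoid algebra of
    [M]: its basis consists of the pairs [(m, n)], that is, m (x) n. *)

Section ProdMonom.
Variables M N : conomType.

Let pone : M * N := (mone, mone).
Let pmul (x y : M * N) : M * N := (mmul x.1 y.1, mmul x.2 y.2).

Fact pmulA : associative pmul.
Proof. by move=> x y z; rewrite /pmul !mulmA. Qed.
Fact pmul1m : left_id pone pmul.
Proof. by case=> x y; rewrite /pmul !mul1m. Qed.
Fact pmulm1 : right_id pone pmul.
Proof. by case=> x y; rewrite /pmul !mulm1. Qed.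
Fact punitm x y : pmul x y = pone -> x = pone /\ y = pone.
Proof. by case: x y => [x x'] [y y'] [/unitm[-> ->] /unitm[-> ->]]. Qed.
Fact pmulC : commutative pmul.
Proof. by move=> x y; rewrite /pmul ![mmul x.1 _]mulmC ![mmul x.2 _]mulmC. Qed.

HB.instance Definition _ :=
  Choice_isMonomialDef.Build (M * N)%type pmulA pmul1m pmulm1 punitm.
HB.instance Definition _ := MonomialDef_isConomialDef.Build (M * N)%type pmulC.

End ProdMonom.

(** * The output feedback Hopf algebra *)

Notation H R := {malg R[{cmonom word}]}.
Notation HH R := {malg R[({cmonom word} * {cmonom word})%type]}.

Section Hopf.
Variable R : comNzRingType.

(* The coordinate function a_w. *)
Definition coordf (w : word) : H R := << ucm w >>.

Definition tensor (p q : H R) : HH R :=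
  \sum_(m <- msupp p) \sum_(n <- msupp q) << p@_m * q@_n *g (m, n) >>.

Definition monom_eval (A : comNzRingType) (c : word -> A) (m : {cmonom word}) : A :=
  \prod_(w <- finsupp m) c w ^+ m w.

Definition monom_eval2 (A : comNzRingType) (c d : word -> A)
    (m : {cmonom word} * {cmonom word}) : A :=
  monom_eval c m.1 * monom_eval d m.2.

(* Evaluation of an element of H (resp. H (x) H) at a series (resp. at a pair
   of series). *)
Definition eval (c : series R) : H R -> R := mmap idfun (monom_eval c).
Definition eval2 (c d : series R) : HH R -> R := mmap idfun (monom_eval2 c d).

Definition counit : H R -> R := eval (fun=> 0).

Definition is_coproduct (Delta : H R -> HH R) : Prop :=
  exists2 tDelta : word -> HH R,
    forall w c d, eval2 c d (tDelta w) = mcomp c d w &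
    forall w, Delta (coordf w) = tDelta w + tensor 1 (coordf w).

(* mu o (f (x) g), for mu : H (x) H -> H the multiplication of H *)
Definition tensor_mul (f g : H R -> H R) (t : HH R) : H R :=
  \sum_(m <- msupp t) t@_m *: (f << m.1 >> * g << m.2 >>).

Definition convolution (Delta : H R -> HH R) (f g : H R -> H R) : H R -> H R :=
  fun h => tensor_mul f g (Delta h).

Definition is_antipode (Delta : H R -> HH R) (S : H R -> H R) : Prop :=
  forall h, convolution Delta S idfun h = (counit h)%:A
         /\ convolution Delta idfun S h = (counit h)%:A.

(* The derivation of H taking the value [f w] on a_w: on a monomial m it is
   the sum over w of (dm / da_w) * f w. *)
Definition derivation (f : word -> H R) (p : H R) : H R :=
  \sum_(m <- msupp p) p@_m *:
    \sum_(w <- finsupp m) (<< divcm m (ucm w) >> * f w) *+ m w.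

Definition theta (i : letter) : H R -> H R := derivation (fun w => coordf (rcons w i)).

Definition theta' (i : letter) : H R -> H R :=
  derivation (fun w => if i then - coordf (rcons w x1)
    else - theta x0 (coordf w) + coordf [::] * theta x1 (coordf w)).

(* For w = x_(i_1) ... x_(i_l), this is theta'_(i_l) o ... o theta'_(i_1). *)
Definition Theta' (w : word) : H R -> H R := foldl (fun F i => theta' i \o F) id w.

End Hopf.

Section Facts.
Variable R : comNzRingType.

Lemma monom_evalEw (A : comNzRingType) (c : word -> A) (m : {cmonom word})
    (d : {fset word}) : (finsupp m `<=` d)%fset ->
  monom_eval c m = \prod_(w <- d) c w ^+ m w.
Proof.
move=> le; rewrite /monom_eval (big_fset_incl _ le) //= => w _ hw.
by rewrite fsfun_dflt ?expr0.
Qed.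

Fact monom_eval_multiplicative (A : comNzRingType) (c : word -> A) :
  mmorphism (monom_eval c).
Proof.
split=> [m n|]; last by rewrite /monom_eval mdom1 big_seq_fset0.
rewrite (@monom_evalEw _ _ m (finsupp m `|` finsupp n)%fset) ?fsubsetUl //.
rewrite (@monom_evalEw _ _ n (finsupp m `|` finsupp n)%fset) ?fsubsetUr //.
rewrite /monom_eval mdomD -big_split /=.
by apply: eq_bigr => w _; rewrite cmM exprD.
Qed.
HB.instance Definition _ (A : comNzRingType) (c : word -> A) :=
  isMultiplicative.Build _ A (monom_eval c) (monom_eval_multiplicative c).

Fact monom_eval2_multiplicative (A : comNzRingType) (c d : word -> A) :
  mmorphism (monom_eval2 c d).
Proof.
split=> [m n|]; last by rewrite /monom_eval2 !mmorph1 mulr1.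
by rewrite /monom_eval2 !mmorphM mulrACA.
Qed.
HB.instance Definition _ (A : comNzRingType) (c d : word -> A) :=
  isMultiplicative.Build _ A (monom_eval2 c d) (monom_eval2_multiplicative c d).

HB.instance Definition _ (c : series R) := GRing.LRMorphism.copy
  (eval c) (mmap idfun (monom_eval c)).
HB.instance Definition _ (c d : series R) := GRing.LRMorphism.copy
  (eval2 c d)
  (mmap idfun (monom_eval2 c d)).

Lemma monom_evalU (A : comNzRingType) (c : word -> A) w : monom_eval c (ucm w) = c w.
Proof. by rewrite /monom_eval mdomU big_seq_fset1 cmUU expr1. Qed.

Lemma eval_coordf (c : series R) w : eval c (coordf R w) = c w.
Proof. by rewrite /eval /coordf mmapU /= mul1r monom_evalU. Qed.

Lemma malgUZ (K : choiceType) (x : R) (k : K) :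
  << x *g k >> = x *: << k >> :> {malg R[K]}.
Proof. by apply/malgP => l; rewrite mcoeffZ !mcoeffU mulrnAr mulr1. Qed.

Lemma tensorUU (x y : R) m n :
  tensor << x *g m >> << y *g n >> = << x * y *g (m, n) >>.
Proof.
rewrite /tensor (@big_fset_incl _ _ _ _ _ [fset m]%fset) ?msuppU_le //; last first.
  move=> k _ /mcoeff_outdom ->; rewrite big1 // => l _.
  by rewrite mul0r monalgU0.
rewrite big_seq_fset1 (@big_fset_incl _ _ _ _ _ [fset n]%fset) ?msuppU_le //.
  by rewrite big_seq_fset1 !mcoeffUU.
by move=> k _ /mcoeff_outdom ->; rewrite mulr0 monalgU0.
Qed.

Lemma eval2_tensor (c d : series R) p q :
  eval2 c d (tensor p q) = eval c p * eval d q.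
Proof.
rewrite /tensor raddf_sum /eval !mmapE mulr_suml; apply: eq_bigr => m _.
rewrite raddf_sum mulr_sumr; apply: eq_bigr => n _.
by rewrite /= /eval2 mmapU /= /monom_eval2 mulrACA.
Qed.

Lemma tensor_mulEw (f g : H R -> H R) (d : {fset ({cmonom word} * {cmonom word})})
  (t : HH R) : (msupp t `<=` d)%fset ->
  tensor_mul f g t = \sum_(m <- d) t@_m *: (f << m.1 >> * g << m.2 >>).
Proof.
move=> le; rewrite /tensor_mul (big_fset_incl _ le) //= => m _ /mcoeff_outdom ->.
by rewrite scale0r.
Qed.

Fact tensor_mul_is_linear (f g : H R -> H R) : linear (tensor_mul f g).
Proof.
move=> k s t.
pose d := (msupp s `|` msupp t `|` msupp (k *: s + t))%fset.
have hs : (msupp s `<=` d)%fset by rewrite /d -fsetUA fsubsetUl.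
have ht : (msupp t `<=` d)%fset by rewrite /d fsetUAC fsubsetUr.
rewrite !(@tensor_mulEw _ _ d) ?fsubsetUr // scaler_sumr -big_split /=.
by apply: eq_bigr => m _; rewrite mcoeffD mcoeffZ scalerDl scalerA.
Qed.
HB.instance Definition _ (f g : H R -> H R) :=
  GRing.isLinear.Build R (HH R) (H R) *:%R (tensor_mul f g) (tensor_mul_is_linear f g).

Lemma tensor_mulU (f g : H R -> H R) k m n :
  tensor_mul f g << k *g (m, n) >> = k *: (f << m >> * g << n >>).
Proof.
rewrite (@tensor_mulEw _ _ [fset (m, n)]%fset) ?msuppU_le //.
by rewrite big_seq_fset1 mcoeffUU.
Qed.

Lemma linear_malgE (K : choiceType) (V : lmodType R) (f : {linear {malg R[K]} -> V})
    (p : {malg R[K]}) : f p = \sum_(m <- msupp p) p@_m *: f << m >>.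
Proof.
rewrite {1}(monalgE p) raddf_sum; apply: eq_bigr => m _.
by rewrite -linearZ -malgUZ.
Qed.

Lemma tensor_mul_tensor (f g : {linear H R -> H R}) p q :
  tensor_mul f g (tensor p q) = f p * g q.
Proof.
rewrite (linear_malgE f p) (linear_malgE g q) /tensor raddf_sum mulr_suml.
apply: eq_bigr => m _; rewrite raddf_sum mulr_sumr; apply: eq_bigr => n _.
rewrite [LHS]tensor_mulU.
by rewrite -scalerAl -scalerAr scalerA.
Qed.

Lemma shuffle_rmorph (A B : comNzRingType) (g : {rmorphism A -> B})
    (c d : series A) (c' d' : series B) w :
    (forall v, g (c v) = c' v) -> (forall v, g (d v) = d' v) ->
  g (shuffle c d w) = shuffle c' d' w.
Proof.
move=> hc hd; rewrite /shuffle rmorph_sum; apply: eq_bigr => u _.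
rewrite rmorph_sum; apply: eq_bigr => v _.
by rewrite rmorphMn rmorphM hc hd.
Qed.

Lemma phi_rmorph (A B : comNzRingType) (g : {rmorphism A -> B})
    (d : series A) (d' : series B) v (e : series A) (e' : series B) w :
    (forall v, g (d v) = d' v) -> (forall v, g (e v) = e' v) ->
  g (phi d v e w) = phi d' v e' w.
Proof.
move=> hd he; elim: v w => //= i v IH w.
have L j (f : series A) (f' : series B) z : (forall v, g (f v) = f' v) ->
    g (lcat j f z) = lcat j f' z.
  move=> hf; case: z => [|k z] /=; first exact: rmorph0.
  by case: eqP => // _; rewrite rmorph0.
case: i => /=; last exact: L.
by rewrite /series_add rmorphD; congr (_ + _); apply: L => // z; apply: shuffle_rmorph.
Qed.

Lemma mcomp_rmorph (A B : comNzRingType) (g : {rmorphism A -> B})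
    (c d : series A) (c' d' : series B) w :
    (forall v, g (c v) = c' v) -> (forall v, g (d v) = d' v) ->
  g (mcomp c d w) = mcomp c' d' w.
Proof.
move=> hc hd; rewrite /mcomp rmorph_sum; apply: eq_bigr => v _.
rewrite rmorphM hc; congr (_ * _); apply: phi_rmorph => // z.
exact: rmorph_nat.
Qed.

Lemma coproduct_exists :
  exists Delta : {lrmorphism H R -> HH R}, is_coproduct Delta.
Proof.
pose tDelta := mcomp (fun w => tensor (coordf R w) 1 : HH R) (fun w => tensor 1 (coordf R w)).
pose D := mmap (in_alg (HH R)) (monom_eval (fun w => tDelta w + tensor 1 (coordf R w) : HH R)) : H R -> HH R.
have Dlin : linear D.
  by move=> k p q; rewrite /D raddfD /= mmapZ /= mulr_algl.
have Dmul : monoid_morphism D.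
  by split; [exact: rmorph1 | exact: rmorphM].
pose a1 := GRing.isLinear.Build R (H R) (HH R) *:%R D Dlin.
pose a2 := GRing.isMonoidMorphism.Build (H R) (HH R) D Dmul.
pose D' : {lrmorphism H R -> HH R} := HB.pack D a1 a2.
exists D', tDelta => w; last first.
  by rewrite /= /D mmapU /= scale1r mul1r monom_evalU.
move=> c d; apply: (@mcomp_rmorph _ _ (eval2 c d)) => v.
  rewrite [LHS]eval2_tensor.
  by rewrite eval_coordf [eval d 1]rmorph1 mulr1.
rewrite [LHS]eval2_tensor.
by rewrite eval_coordf [eval c 1]rmorph1 mul1r.
Qed.

Lemma derivationEw (f : word -> H R) (d : {fset {cmonom word}}) p :
  (msupp p `<=` d)%fset -> derivation f p = \sum_(m <- d) p@_m *:
    \sum_(w <- finsupp m) (<< divcm m (ucm w) >> * f w) *+ m w.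
Proof.
move=> le; rewrite /derivation (big_fset_incl _ le) //= => m _ /mcoeff_outdom ->.
by rewrite scale0r.
Qed.

Fact derivation_is_linear (f : word -> H R) : linear (derivation f).
Proof.
move=> k s t.
pose d := (msupp s `|` msupp t `|` msupp (k *: s + t))%fset.
have hs : (msupp s `<=` d)%fset by rewrite /d -fsetUA fsubsetUl.
have ht : (msupp t `<=` d)%fset by rewrite /d fsetUAC fsubsetUr.
rewrite !(@derivationEw _ d) ?fsubsetUr // scaler_sumr -big_split /=.
by apply: eq_bigr => m _; rewrite mcoeffD mcoeffZ scalerDl scalerA.
Qed.
HB.instance Definition _ (f : word -> H R) :=
  GRing.isLinear.Build R (H R) (H R) *:%R (derivation f) (derivation_is_linear f).

Lemma derivationU (f : word -> H R) (m : {cmonom word}) (d : {fset word}) :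
  (finsupp m `<=` d)%fset -> derivation f << m >> =
    \sum_(w <- d) (<< divcm m (ucm w) >> * f w) *+ m w.
Proof.
move=> le; rewrite (@derivationEw _ [fset m]%fset) ?msuppU_le //.
rewrite big_seq_fset1 mcoeffUU scale1r (big_fset_incl _ le) //= => w _ hw.
by rewrite fsfun_dflt.
Qed.

Lemma derivation_coordf (f : word -> H R) w : derivation f (coordf R w) = f w.
Proof.
rewrite (@derivationU _ _ [fset w]%fset) ?mdomU ?fsubset_refl // big_seq_fset1 cmUU.
suff -> : divcm (ucm w) (ucm w) = mone by rewrite mul1r.
by apply/eqP/cmP => i; rewrite divcmE cm1 subnn.
Qed.

Lemma malgUUM (K : monomType) (m n : K) :
  << m >> * << n >> = << (mmul m n) >> :> {malg R[K]}.
Proof. by rewrite malgM_def fgmulUU mulr1. Qed.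

Lemma divcmMl (m n : {cmonom word}) w : (0 < m w)%N ->
  mmul (divcm m (ucm w)) n = divcm (mmul m n) (ucm w).
Proof.
move=> m0; apply/eqP/cmP => v.
rewrite divcmE !cmM divcmE cmU; case: eqP => [<-|_]; first by rewrite addnBAC.
by rewrite !subn0.
Qed.

Fact derivationM_monom (f : word -> H R) (m n : {cmonom word}) :
  derivation f (<< m >> * << n >>)
    = derivation f << m >> * << n >> + << m >> * derivation f << n >>.
Proof.
rewrite malgUUM; pose d := (finsupp m `|` finsupp n)%fset.
have hmn : (finsupp (mmul m n) `<=` d)%fset by rewrite mdomD.
have hm : (finsupp m `<=` d)%fset by apply: fsubsetUl.
have hn : (finsupp n `<=` d)%fset by apply: fsubsetUr.
pose F k : H R := \sum_(w <- d) (<< divcm k (ucm w) >> * f w) *+ k w.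
have aux (x y z : H R) : x = F (mmul m n) -> y = F m -> z = F n ->
    x = y * << n >> + << m >> * z; last first.
  exact: (aux _ _ _ (derivationU f hmn) (derivationU f hm) (derivationU f hn)).
move=> -> -> ->; rewrite {x y z}.
have key w : (<< divcm (mmul m n) (ucm w) >> * f w) *+ (mmul m n) w =
   (<< divcm m (ucm w) >> * f w) *+ m w * << n >> +
   << m >> * ((<< divcm n (ucm w) >> * f w) *+ n w) :> H R.
  have r1 (T : comNzRingType) (a b c : T) k : a * b *+ k * c = a * c * b *+ k.
    by rewrite mulrnAl mulrAC.
  have r2 (T : comNzRingType) (a b c : T) k : c * (a * b *+ k) = a * c * b *+ k.
    by rewrite mulrnAr mulrA [c * a]mulrC.
  have s1 (k l : {cmonom word}) : (<< divcm k (ucm w) >> * << l >> * f w) *+ k w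
      = (<< divcm (mmul k l) (ucm w) >> * f w) *+ k w :> H R.
    case: (posnP (k w)) => [->|m0].
      exact: (etrans (mulr0n _) (esym (mulr0n _))).
    apply: (congr1 (fun t : H R => (t * f w) *+ k w)).
    apply: etrans (malgUUM _ _) _.
    exact: (congr1 (fun z => << z >>) (divcmMl l m0)).
  apply: esym; apply: etrans (congr2 _ (r1 _ _ _ _ _) (r2 _ _ _ _ _)) _.
  apply: etrans (congr2 _ (s1 m n) (s1 n m)) _.
  by rewrite (mulmC n m) cmM mulrnDr.
apply: etrans (eq_bigr _ (fun w _ => key w)) _.
by rewrite big_split; congr (_ + _); apply: esym; [apply: mulr_suml|apply: mulr_sumr].
Qed.

Fact leibniz_span (A : comAlgType R) (G : {linear A -> A}) (I : Type)
    (r s : seq I) (b : I -> A) (k l : I -> R) :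
    (forall i j, G (b i * b j) = G (b i) * b j + b i * G (b j)) ->
  let x := \sum_(i <- r) k i *: b i in let y := \sum_(j <- s) l j *: b j in
  G (x * y) = G x * y + x * G y.
Proof.
move=> h x y; rewrite /x mulr_suml [G (bigop _ _ _)]linear_sum /=.
rewrite [G (bigop _ _ _)]linear_sum /= !mulr_suml -big_split /=.
apply: eq_bigr => i _; rewrite /y mulr_sumr [G (bigop _ _ _)]linear_sum /=.
rewrite [G (bigop _ _ _)]linear_sum /= !mulr_sumr -big_split /=.
apply: eq_bigr => j _; rewrite [G (k i *: _)]linearZ [G (l j *: _)]linearZ.
by rewrite -!scalerAr -!scalerAl !linearZ /= !scalerA h [l j * _]mulrC scalerDr.
Qed.

Lemma derivationM (f : word -> H R) (p q : H R) :
  derivation f (p * q) = derivation f p * q + p * derivation f q.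
Proof.
have E (x : H R) : x = \sum_(m <- msupp x) x@_m *: << m >>.
  exact: (linear_malgE idfun x).
rewrite (E p) (E q).
apply: (@leibniz_span _ (derivation f)) => m n; exact: derivationM_monom.
Qed.

End Facts.

(* Main.v *)
Require Import Defs.
From mathcomp Require Import all_boot all_order all_algebra.
From mathcomp Require Import finmap.
From mathcomp Require Import reals.
From mathcomp.multinomials Require Import monalg.

(** Work with series whose coefficients lie in [H] itself, and let [a] be the
    generic series, [a w = coordf w]. The composition product [mcomp c d] is
    linear in [c], and an element of [H] (x) [H] is determined by its values
    at pairs of series ([eval2_inj], by independence of characters), so the
    coproduct of [a_w] is given by the formula for [mcomp] itself
    ([coproduct_coordf]). The defining identity of the antipode then becomes a
    linear equation for the series [s w = S (a w)], namely [mcomp s a = - a]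
    ([antipode_mcomp]). The matrix of this system, with entries
    [phi a v 1 w], is unitriangular for the grading ([phi_triangular]), so [s]
    is its only solution ([mcomp_eq0]).

    It remains to see that [t w = (-1)^|w| Theta'_w (a_0)], with [a_0] the
    coordinate function of the empty word, satisfies [mcomp t a = a]; then
    [s = - t], which is the formula. The identity [mcomp t a w = a w] is proved
    by adding letters on the right of [w]. By definition
    [a (rcons w i) = theta i (a w)]: on the generic series, the right derivative,
    which sends [c] to [w |-> c (rcons w i)], coincides with the derivation
    [theta i] applied to the coefficients. Both are derivations of the shuffle
    product, so they nearly coincide on the series [phi a v 1] built from [a] by
    shuffles: for [v = v' x_j] the defect is [phi a v' 1] when [i = j], it is
    [a_0] times [phi a v' 1] when [i = 0] and [j = 1], and it is zero otherwise
    ([phi_series1_rcons]). In [mcomp t a] the defects are absorbed provided that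
    [theta 1 (t v) = t (v x_1)] and
    [theta 0 (t v) = t (v x_0) + a_0 * t (v x_1)], that is, when [t] is built by
    the derivations [- theta'_i] ([theta_signed_Theta']); then
    [mcomp t a (rcons w i)] is [theta i (mcomp t a w)] ([mcomp_rcons]). *)

Local Open Scope ring_scope.

Set Implicit Arguments.
Unset Strict Implicit.
Unset Printing Implicit Defensive.

Import GRing.Theory Num.Theory.

(** * Sums over words *)

Lemma big_words_upto_cons (V : nmodType) n (F : word -> V) :
  \sum_(v <- words_upto n.+1) F v = F [::] +
    \sum_(v <- words_upto n) (F (x0 :: v) + F (x1 :: v)).
Proof.
rewrite big_split /= -(big_map (cons x0) xpredT) -(big_map (cons x1) xpredT).
rewrite -big_cat -(big_cons _ _ [::] _ xpredT); apply: perm_big; apply: uniq_perm.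
- exact: uniq_words_upto.
- rewrite cons_uniq cat_uniq !map_inj_uniq ?uniq_words_upto //; try by move=> ? ? [].
  rewrite mem_cat negb_or !andbT !andTb -andbA; apply/and3P; split.
  + by apply/mapP => -[].
  + by apply/mapP => -[].
  + by apply/hasPn => _ /mapP[w _ ->]; apply/negP => /mapP[].
move=> [|i w]; rewrite mem_words_upto in_cons // orFb mem_cat.
have -> : (size (i :: w) <= n.+1)%N = (w \in words_upto n) by rewrite mem_words_upto.
case: i.
  rewrite orbC mem_map; last by move=> ? ? [].
  by case: (w \in _) => //=; apply/esym/negP => /mapP[].
rewrite mem_map; last by move=> ? ? [].
by case: (w \in _) => //=; apply/esym/negP => /mapP[].
Qed.

Lemma big_words_upto_rev (V : nmodType) n (F : word -> V) :
  \sum_(v <- words_upto n) F v = \sum_(v <- words_upto n) F (rev v).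
Proof.
rewrite -(big_map rev xpredT); apply: perm_big; apply: uniq_perm.
- exact: uniq_words_upto.
- by rewrite (map_inj_uniq (can_inj (@revK _))) uniq_words_upto.
by move=> w; rewrite -[w in RHS]revK (mem_map (can_inj (@revK _))) !mem_words_upto size_rev.
Qed.

Lemma big_words_upto_rcons (V : nmodType) n (F : word -> V) :
  \sum_(v <- words_upto n.+1) F v = F [::] +
    \sum_(v <- words_upto n) (F (rcons v x0) + F (rcons v x1)).
Proof.
rewrite big_words_upto_rev big_words_upto_cons; congr (_ + _).
rewrite [RHS]big_words_upto_rev; apply: eq_bigr => v _.
by rewrite !rev_cons.
Qed.

Lemma big_words_upto_widen (V : nmodType) n N (F : word -> V) :
    (n <= N)%N -> (forall v, (n < size v)%N -> F v = 0) ->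
  \sum_(v <- words_upto N) F v = \sum_(v <- words_upto n) F v.
Proof.
move=> le F0; rewrite (bigID (fun v : word => size v <= n)%N) /=.
rewrite [X in _ + X]big1 ?addr0; last by move=> v; rewrite -ltnNge => /F0.
rewrite -big_filter; apply: perm_big; apply: uniq_perm.
- exact/filter_uniq/uniq_words_upto.
- exact: uniq_words_upto.
move=> v; rewrite mem_filter !mem_words_upto.
by case: leqP => //= h; rewrite (leq_trans h le).
Qed.

(** * The shuffle product by recursion on the first letter *)

Lemma count_shuffle_cons i w u v :
  count_mem (i :: w) (shuffle_words u v) =
    ((if u is k :: u' then (k == i) * count_mem w (shuffle_words u' v) else 0) +
     (if v is k :: v' then (k == i) * count_mem w (shuffle_words u v') else 0))%N.
Proof.
have C k s : count_mem (i :: w) [seq k :: z | z <- s] = ((k == i) * count_mem w s)%N.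
  rewrite count_map /=; case: eqP => [->|ne].
    by rewrite mul1n; apply: eq_count => z /=; rewrite eqseq_cons eqxx.
  rewrite mul0n; apply/eqP; rewrite -leqn0 leqNgt -has_count.
  by apply/hasPn => z _ /=; rewrite eqseq_cons; case: eqP.
case: u v => [|k u] [|l v] //=.
- by rewrite eqseq_cons; case: (l == i); rewrite ?mul1n ?mul0n ?addn0.
- case: u => [|k' u] /=; rewrite eqseq_cons; case: (k == i);
    by rewrite ?mul1n ?mul0n ?addn0.
- by rewrite count_cat !C.
Qed.

Section Series.
Variable A : comNzRingType.
Implicit Types c d e f : series A.

(** The bounds on the lengths of the words in [shuffle] can be relaxed, which
    gives the recursion on the first letter the freedom to shift them. *)
Lemma shuffle_widen N M c d w : (size w <= N)%N -> (size w <= M)%N ->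
  shuffle c d w = \sum_(u <- words_upto N) \sum_(v <- words_upto M)
    (c u * d v) *+ count_mem w (shuffle_words u v).
Proof.
have cnt0 u v : (size w < size u + size v)%N -> count_mem w (shuffle_words u v) = 0%N.
  move=> h; apply/count_memPn/negP => /size_shuffle_words E.
  by rewrite E ltnn in h.
move=> hN hM; rewrite /shuffle (big_words_upto_widen hN); last first.
  move=> u hu; rewrite big1 // => v _; rewrite cnt0 //.
  exact: leq_trans hu (leq_addr _ _).
apply: eq_bigr => u _; rewrite [RHS](big_words_upto_widen hM) // => v hv.
rewrite cnt0 //; exact: leq_trans hv (leq_addl _ _).
Qed.

Lemma shuffle_nil c d : shuffle c d [::] = c [::] * d [::].
Proof. by rewrite /shuffle !big_cons !big_nil /= !addr0. Qed.

Lemma shuffle_cons c d i w :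
  shuffle c d (i :: w) =
    shuffle (fun v => c (i :: v)) d w + shuffle c (fun v => d (i :: v)) w.
Proof.
have hw : (size w <= (size w).+1)%N by [].
rewrite (shuffle_widen (fun v => c (i :: v)) d (leqnn (size w)) hw).
rewrite (shuffle_widen c (fun v => d (i :: v)) hw (leqnn (size w))).
rewrite /shuffle [size (i :: w)]/=.
under eq_bigr => u _ do under eq_bigr => v _ do
  rewrite count_shuffle_cons mulrnDr.
under eq_bigr => u _ do rewrite big_split /=.
rewrite big_split; congr (_ + _).
  rewrite big_words_upto_cons big1 ?add0r //.
  apply: eq_bigr => u _; rewrite -big_split; apply: eq_bigr => v _ /=.
  by case: i; rewrite ?mul1n ?mul0n ?mulr0n ?addr0 ?add0r.
apply: eq_bigr => u _; rewrite big_words_upto_cons mulr0n add0r.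
apply: eq_bigr => v _ /=.
by case: i; rewrite ?mul1n ?mul0n ?mulr0n ?addr0 ?add0r.
Qed.

Lemma shuffle_scaler c (k : A) e w :
  shuffle c (fun v => k * e v) w = k * shuffle c e w.
Proof.
elim: w c e => [|i w IH] c e; first by rewrite !shuffle_nil mulrCA.
by rewrite !shuffle_cons !IH mulrDr.
Qed.

Lemma shuffle1r c w : shuffle c (series1 A) w = c w.
Proof.
elim: w c => [|i w IH] c; first by rewrite shuffle_nil mulr1.
rewrite shuffle_cons (IH (fun v => c (i :: v))).
rewrite (_ : shuffle c _ w = 0) ?addr0 // /shuffle.
by rewrite big1 // => ? _; rewrite big1 // => ? _; rewrite mulr0 mul0rn.
Qed.

Lemma phi_letter_nil d j e : phi_letter d j e [::] = 0.
Proof. by case: j; rewrite //= /series_add addr0. Qed.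

Lemma phi_scale d v (k : A) e w : phi d v (fun u => k * e u) w = k * phi d v e w.
Proof.
elim: v w => //= j v IH w.
have L l (f g : series A) z : (forall u, f u = k * g u) -> lcat l f z = k * lcat l g z.
  by move=> h; case: z => [|m z] /=; rewrite ?mulr0 //; case: eqP; rewrite ?mulr0.
case: j => /=; last exact: L.
rewrite /series_add mulrDr; congr (_ + _); apply: L => // u.
rewrite -shuffle_scaler; exact: (@shuffle_rmorph _ _ idfun).
Qed.

(** * Right derivatives of series *)

Section Derivative.
Variables (delta : {additive A -> A}) (i : letter).
Hypothesis deltaM : forall p q, delta (p * q) = delta p * q + p * delta q.

Lemma leibniz_one : delta 1 = 0.
Proof. by apply: (addIr (delta 1)); rewrite add0r -{3}[1]mulr1 deltaM mulr1 mul1r. Qed.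

(** By symmetry of the shuffle product its last letter can be peeled off like
    the first one, so that [c |-> (w |-> c (rcons w i))] is a derivation for it.
    Here [f] is the defect of [e]: the difference between this derivation and
    [delta] applied to the coefficients. Both being derivations, the defect
    passes to the product with a series of zero defect. *)
Lemma shuffle_rcons c e f :
    (forall w, c (rcons w i) = delta (c w)) ->
    (forall w, e (rcons w i) = delta (e w) + f w) ->
  forall w, shuffle c e (rcons w i) = delta (shuffle c e w) + shuffle c f w.
Proof.
move=> hc he w; elim: w c e f hc he => [|k w IH] c e f hc he.
  rewrite /= shuffle_cons !shuffle_nil (hc [::]) (he [::]) deltaM.
  by rewrite mulrDr addrA.
rewrite rcons_cons !shuffle_cons raddfD.
rewrite (IH _ e f) ?(IH c _ (fun v => f (k :: v))) // => [|v|v].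
- by rewrite addrACA.
- exact: (he (k :: v)).
- exact: (hc (k :: v)).
Qed.

Lemma lcat_rcons j e f :
    e [::] = 0 -> (forall w, e (rcons w i) = delta (e w) + f w) ->
  forall w, lcat j e (rcons w i) = delta (lcat j e w) + lcat j f w.
Proof.
move=> e0 he [|k w] /=; first by rewrite e0 if_same raddf0 addr0.
by case: eqP => // _; rewrite raddf0 addr0.
Qed.

Variable d : series A.
Hypothesis d_rcons : forall w, d (rcons w i) = delta (d w).

(** The operators [phi_letter d j] transport the defect because [d] has none.
    The condition on [e [::]] is what prepending a letter needs: prepending [j]
    to the empty word creates a new final letter [j]. *)
Lemma phi_rcons v e f :
    e [::] = 0 -> (forall w, e (rcons w i) = delta (e w) + f w) ->
  forall w, phi d v e (rcons w i) = delta (phi d v e w) + phi d v f w.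
Proof.
move=> e0 he; elim: v => //= j v IH.
have p0 : phi d v e [::] = 0 by case: v {IH} => //= k v; apply: phi_letter_nil.
case: j => w /=; last exact: lcat_rcons.
rewrite /series_add (lcat_rcons _ p0 IH) (lcat_rcons _ _ (shuffle_rcons d_rcons IH)).
  by rewrite raddfD addrACA.
by rewrite shuffle_nil p0 mulr0.
Qed.

(** All of the defect of [phi d (rcons v j) 1] comes from its innermost step,
    where [x_j] gives [x_j], and [x_1] gives also [x_0 d], whose coefficient at
    [x_0] is [d [::]]; the remaining letters [v] carry it outwards. *)
Lemma phi_series1_rcons v j w :
  phi d (rcons v j) (series1 A) (rcons w i) =
    delta (phi d (rcons v j) (series1 A) w) +
    ((j == i)%:R + (j && ~~ i)%:R * d [::]) * phi d v (series1 A) w.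
Proof.
have E u e : phi d (rcons u j) e = phi d u (phi_letter d j e).
  by elim: u => //= l u ->.
rewrite !E -phi_scale; apply: phi_rcons; first exact: phi_letter_nil.
have L l z : lcat l (series1 A) (rcons z i) =
    delta (lcat l (series1 A) z) + (l == i)%:R * series1 A z.
  case: z => [|m z] /=; rewrite /series1 /=.
    by rewrite raddf0 add0r mulr1 eq_sym; case: (_ == _).
  rewrite mulr0 addr0; case: (_ == _); rewrite ?raddf0 //.
  by case: z => [|? ?] /=; rewrite ?raddf0 ?leibniz_one.
move=> z; case: j {E} => /=; last first.
  by rewrite mul0r addr0 L.
rewrite /series_add L raddfD mulrDl -!addrA; congr (_ + _).
rewrite addrCA; congr (_ + _).
case: z => [|m z] /=; rewrite /series1 /=.
  by rewrite raddf0 add0r mulr1 shuffle1r; case: i; rewrite ?mul0r ?mul1r.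
by rewrite mulr0 addr0; case: eqP; rewrite ?raddf0 // !shuffle1r d_rcons.
Qed.

(** The hypothesis on [c] makes the defects of the series [phi d v 1]
    disappear: the terms that they contribute for the words [rcons v x0] and
    [rcons v x1] recombine into [delta (c v) * phi d v 1 w]. *)
Lemma mcomp_rcons c :
    (forall v, delta (c v) = c (rcons v i) + (~~ i)%:R * d [::] * c (rcons v x1)) ->
  forall w, mcomp c d (rcons w i) = delta (mcomp c d w).
Proof.
move=> hc w; pose n := size w; rewrite /mcomp size_rcons raddf_sum.
under [RHS]eq_bigr => v _ do rewrite deltaM addrC.
rewrite [RHS]big_split /=.
rewrite -(@big_words_upto_widen _ n n.+1) // => [|v hv]; last first.
  by rewrite phi_small // raddf0 mulr0.
rewrite !big_words_upto_rcons -addrA; congr (_ + _).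
  by congr (_ * _); case: w {n} => [|? ?]; rewrite /= /series1 /= ?raddf0 ?leibniz_one.
rewrite -big_split; apply: eq_bigr => v _ /=.
rewrite hc !phi_series1_rcons !mulrDr -!addrA; congr (_ + _).
rewrite addrCA; congr (_ + _); rewrite mulrDl.
case: i => /=; first by rewrite !(mul0r, mulr0, mul1r, mulr1, add0r, addr0).
by rewrite !(mul0r, mul1r, add0r, addr0, mulrDl) !mulrA [d [::] * _]mulrC.
Qed.

End Derivative.

(** * Triangularity of the composition product *)

(** This is [deg w - 1]. *)
Fixpoint weight (w : word) : nat :=
  if w is i :: w' then (if i then 1 else 2) + weight w' else 0.

(** Shuffling with [c] never lowers the weight. *)
Lemma shuffle_vanish n c e :
    (forall w, (weight w < n)%N -> e w = 0) ->
  forall w, (weight w < n)%N -> shuffle c e w = 0.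
Proof.
move=> he w; elim: w n c e he => [|i w IH] n c e he hw.
  by rewrite shuffle_nil he ?mulr0.
rewrite shuffle_cons.
rewrite (IH n) // ?add0r; last by apply: leq_ltn_trans hw; apply: leq_addl.
apply: (IH (n - (if i then 1 else 2))%N).
  by move=> v hv; apply: he; rewrite /= -ltn_subRL.
by rewrite ltn_subRL.
Qed.

(** In [phi d v 1] the word [v] itself occurs once; every other term trades at
    least one [x1] (weight 1) for an [x0] (weight 2) and shuffles in words of
    [d], and so is heavier. *)
Lemma phi_triangular d v w :
  (weight w <= weight v)%N -> phi d v (series1 A) w = (w == v)%:R.
Proof.
elim: v w => [|i v IH] [|j w] //; first by rewrite [LHS]phi_letter_nil.
rewrite eqseq_cons; case: i; case: j; rewrite /= /series_add /= ?addr0 ?add0r.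
- by rewrite !add1n ltnS; apply: IH.
- rewrite add1n add2n => h; apply: (@shuffle_vanish (weight v)) => //.
  move=> u hu; rewrite IH; last exact: ltnW.
  by case: eqP hu => // ->; rewrite ltnn.
- by [].
- by rewrite !add2n !ltnS; apply: IH.
Qed.

(** A triangular system with unit diagonal has only the zero solution. *)
Lemma mcomp_eq0 c d : (forall w, mcomp c d w = 0) -> forall w, c w = 0.
Proof.
move=> h w; have [n] := ubnP (weight w); elim: n w => // n IH w hw.
rewrite -(h w) /mcomp (bigD1_seq w) ?uniq_words_upto ?mem_words_upto //=.
rewrite phi_triangular // eqxx mulr1 big1 ?addr0 // => v ne.
case: (ltnP (weight v) (weight w)) => hv.
  by rewrite IH ?mul0r //; apply: leq_trans hv _.
by rewrite phi_triangular // eq_sym (negPf ne) mulr0.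
Qed.

End Series.

(** * Evaluations determine elements of the tensor square *)

(** Dedekind's lemma. Subtracting [chi k y] times the relation at [x] from the
    relation at [mul y x] eliminates [k], and leaves the coefficient of [l]
    multiplied by [chi l y - chi k y], which is nonzero for a suitable [y]. *)
Lemma characters_independent (A : idomainType) (G : Type) (one : G)
    (mul : G -> G -> G) (K : eqType) (chi : K -> G -> A) :
    (forall k, chi k one = 1) ->
    (forall k x y, chi k (mul x y) = chi k x * chi k y) ->
    (forall k l, k != l -> exists x, chi k x != chi l x) ->
  forall (s : seq K) (a : K -> A), uniq s ->
    (forall x, \sum_(k <- s) a k * chi k x = 0) -> {in s, forall k, a k = 0}.
Proof.
move=> chi1 chiM sep; elim=> // k s IH a /andP[ks us] h.
have as0 : {in s, forall l, a l = 0}.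
  move=> l ls; have ne : l != k by apply: contraNneq ks => <-.
  have [y hy] := sep _ _ ne.
  have /eqP : a l * (chi l y - chi k y) = 0.
    apply: (IH (fun m => a m * (chi m y - chi k y))) => // x.
    transitivity (\sum_(m <- k :: s) a m * chi m (mul y x)
                  - chi k y * \sum_(m <- k :: s) a m * chi m x).
      rewrite mulr_sumr -sumrB big_cons chiM mulrCA subrr add0r.
      by apply: eq_bigr => m _; rewrite chiM mulrBr mulrBl !mulrA [chi k y * _]mulrC.
    by rewrite !h mulr0 subr0.
  by rewrite mulf_eq0 subr_eq0 (negPf hy) orbF => /eqP.
move=> l; rewrite inE => /predU1P[->|]; last exact: as0.
have := h one; rewrite big_cons chi1 mulr1 big1_seq ?addr0 // => m /andP[_ ms].
by rewrite as0 ?mul0r.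
Qed.

Section Hopf.
Variable R : numDomainType.

(** Evaluating at 2 in one variable and at 1 in the others reads off the
    exponent of that variable. *)
Lemma monom_eval_separates (m n : {cmonom word}) :
  m != n -> exists c : word -> R, monom_eval c m != monom_eval c n.
Proof.
move=> ne; have [w hw] : exists w, m w != n w.
  case: (boolP (has (fun w => m w != n w) (finsupp m `|` finsupp n)%fset)).
    by case/hasP => w _ hw; exists w.
  move/hasPn => h; case/negP: ne; apply/cmP => w.
  case: (boolP (w \in (finsupp m `|` finsupp n)%fset)) => [/h|].
    by rewrite negbK => /eqP.
  by rewrite in_fsetU negb_or => /andP[hm hn]; rewrite !fsfun_dflt.
pose c v : R := if v == w then 2%:R else 1.
have E k : monom_eval c k = 2%:R ^+ k w.
  rewrite (@monom_evalEw _ c k (finsupp k `|` [fset w])%fset) ?fsubsetUl //.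
  rewrite (big_fsetD1 w) /= ?in_fsetU ?in_fset1 ?eqxx ?orbT //.
  rewrite {1}/c eqxx big_seq big1 ?mulr1 // => v.
  by rewrite in_fsetD1 /c => /andP[/negPf-> _]; rewrite expr1n.
by exists c; rewrite !E -!natrX eqr_nat eqn_exp2l.
Qed.

(** The evaluations of the monomials of [H] (x) [H] are distinct characters of
    the monoid of pairs of series under coefficientwise multiplication. *)
Lemma eval2_inj (p q : HH R) :
  (forall c d, eval2 c d p = eval2 c d q) -> p = q.
Proof.
move=> h; apply/eqP; rewrite -subr_eq0; apply/eqP; set r := p - q.
have r0 c d : eval2 c d r = 0.
  by rewrite /r /eval2 raddfB /= -[mmap _ _ p]/(eval2 c d p) h subrr.
pose K : eqType := ({cmonom word} * {cmonom word})%type.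
pose G := ((word -> R) * (word -> R))%type.
pose chi (k : K) (x : G) : R := monom_eval2 x.1 x.2 k.
pose cmul (x y : word -> R) v := x v * y v.
have mulE (x y : word -> R) m :
    monom_eval (cmul x y) m = monom_eval x m * monom_eval y m.
  by rewrite /monom_eval -big_split; apply: eq_bigr => v _; rewrite exprMn.
have oneE m : monom_eval (fun=> 1 : R) m = 1.
  by rewrite /monom_eval big1 // => v _; rewrite expr1n.
have h0 : {in (msupp r : seq K), forall k, r@_k = 0}.
  apply: (@characters_independent R G (fun=> 1, fun=> 1)
    (fun x y => (cmul x.1 y.1, cmul x.2 y.2)) K chi).
  - by move=> k; rewrite /chi /monom_eval2 !oneE mulr1.
  - by move=> k x y; rewrite /chi /monom_eval2 !mulE mulrACA.
  - move=> [m n] [m' n']; rewrite /chi /monom_eval2 /= xpair_eqE negb_and.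
    case/orP => /monom_eval_separates[c hc].
      by exists (c, fun=> 1); rewrite /= !oneE !mulr1.
    by exists (fun=> 1, c); rewrite /= !oneE !mul1r.
  - exact: fset_uniq.
  - by move=> [c d]; rewrite -[RHS](r0 c d) /eval2 mmapE.
apply/malgP => k; rewrite mcoeff0.
by case: (boolP (k \in msupp r)) => [/h0|/mcoeff_outdom].
Qed.

(** * The antipode *)

(** A derivation depends linearly on its values on the generators. *)
Lemma derivation_comb (f g h : word -> H R) (b : H R) :
    (forall w, h w = - f w + b * g w) ->
  forall p, derivation h p = - derivation f p + b * derivation g p.
Proof.
move=> hE p; rewrite /derivation mulr_sumr -sumrN -big_split.
apply: eq_bigr => m _ /=; rewrite -scalerAr -scalerN -scalerDr; congr (_ *: _).
rewrite mulr_sumr -sumrN -big_split; apply: eq_bigr => w _ /=.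
by rewrite hE mulrDr mulrnDl mulrN mulNrn mulrnAr mulrCA.
Qed.

(** The opposite of the values of the antipode, so that the composition product
    with the generic series [coordf] gives back [coordf] without a sign. *)
Definition signed_Theta' (w : word) : H R := (-1) ^+ size w * Theta' w (coordf R [::]).

Lemma Theta'_rcons w i (p : H R) : Theta' (rcons w i) p = theta' i (Theta' w p).
Proof. by rewrite /Theta' foldl_rcons. Qed.

Lemma theta'1 (p : H R) : theta' x1 p = - theta x1 p.
Proof.
rewrite /theta' (@derivation_comb (fun w => coordf R (rcons w x1)) (fun=> 0) _ 0).
  by rewrite mul0r addr0.
by move=> w; rewrite mulr0 addr0.
Qed.

Lemma theta'0 (p : H R) :
  theta' x0 p = - theta x0 p + coordf R [::] * theta x1 p.
Proof.
pose f i w := coordf R (rcons w i).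
have E w : - theta x0 (coordf R w) + coordf R [::] * theta x1 (coordf R w)
    = - f x0 w + coordf R [::] * f x1 w.
  by congr (- _ + _ * _); apply: derivation_coordf.
exact: (derivation_comb E p).
Qed.

(** This solves [theta'_1 = - theta_1] and [theta'_0 = - theta_0 + a_0 theta_1]
    for [theta_1] and [theta_0], where [a_0] is the coordinate function of the
    empty word, and is what [mcomp_rcons] requires of the series
    [signed_Theta']. *)
Lemma theta_signed_Theta' w i :
  theta i (signed_Theta' w) =
    signed_Theta' (rcons w i) + (~~ i)%:R * coordf R [::] * signed_Theta' (rcons w x1).
Proof.
have aug_rcons j : signed_Theta' (rcons w j) =
    (-1) ^+ (size w).+1 * theta' j (Theta' w (coordf R [::])).
  by rewrite /signed_Theta' size_rcons Theta'_rcons.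
(* Stated for variables: in [H] unification would unfold the derivations. *)
have alg (A : comNzRingType) (s t0 t1 b : A) :
    s * t0 = - s * (- t0 + b * t1) + 1 * b * (- s * - t1).
  by rewrite mul1r mulrDr !mulrNN mulNr [b * (s * t1)]mulrCA subrK.
rewrite !aug_rcons theta'1 exprS mulN1r.
apply: etrans (raddfMsign (derivation _) _ _) _.
case: i {aug_rcons}; last by rewrite theta'0; apply: alg.
by rewrite theta'1 mulrNN !mul0r addr0.
Qed.

(** Both sides agree at the empty word, and both turn appending [x_i] to the
    word into applying [theta i]. *)
Lemma mcomp_signed_Theta' w : mcomp signed_Theta' (coordf R) w = coordf R w.
Proof.
have a_rcons i v : coordf R (rcons v i) = theta i (coordf R v).
  by rewrite [RHS]derivation_coordf.
elim/last_ind: w => [|w i IH].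
  by rewrite /mcomp big_cons big_nil /signed_Theta' /= /series1 /= addr0 mulr1 mul1r.
rewrite a_rcons -IH.
apply: (@mcomp_rcons _ (theta i) i (derivationM _) _ (a_rcons i)) => v.
exact: theta_signed_Theta'.
Qed.

(** An element of [H] (x) [H] is determined by its evaluations, and evaluation
    commutes with the formula that defines [phi]. *)
Lemma coproduct_coordf (Delta : H R -> HH R) w : is_coproduct Delta ->
  Delta (coordf R w) =
    \sum_(v <- words_upto (size w))
       tensor (coordf R v) (phi (coordf R) v (series1 _) w)
    + tensor 1 (coordf R w).
Proof.
case=> tDelta tE ->; congr (_ + _); apply: eval2_inj => c d.
rewrite tE [RHS]raddf_sum; apply: eq_bigr => v _.
rewrite [RHS]eval2_tensor eval_coordf; congr (_ * _).
apply/esym/(@phi_rmorph _ _ (eval d)) => u; [exact: eval_coordf | exact: rmorph_nat].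
Qed.

(** This is the half of the antipode identity with [S] on the left factor.
    Since the coproduct of [a_w] is linear in that factor, it involves [S] at
    coordinate functions and at 1 only. *)
Lemma antipode_mcomp (Delta : {lrmorphism H R -> HH R}) (S : {linear H R -> H R}) :
    is_coproduct Delta -> is_antipode Delta S ->
  forall w, mcomp (fun v => S (coordf R v)) (coordf R) w = - coordf R w.
Proof.
move=> hD hS w.
have T1 : tensor 1 1 = 1 :> HH R by rewrite [LHS]tensorUU mulr1.
have SM p q : tensor_mul S idfun (tensor p q) = S p * q.
  exact: (tensor_mul_tensor S idfun).
have S1 : S 1 = 1.
  have [h _] := hS 1; move: h; rewrite /convolution rmorph1 -T1 SM mulr1 => ->.
  by rewrite [counit 1]rmorph1 scale1r.
apply/eqP; rewrite -addr_eq0; apply/eqP.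
have [h _] := hS (coordf R w); move: h.
rewrite /convolution (coproduct_coordf _ hD) /counit eval_coordf scale0r => <-.
apply/esym/(etrans (raddfD (tensor_mul S idfun) _ _)); congr (_ + _).
  apply: etrans (raddf_sum (tensor_mul S idfun) _ _ _) _.
  by apply: eq_bigr => v _; apply: SM.
exact: etrans (SM _ _) (etrans (congr1 ( *%R^~ _) S1) (mul1r _)).
Qed.

End Hopf.

Theorem proposition9 (R : realType)
    (Delta : {lrmorphism H R -> HH R}) (hDelta : is_coproduct Delta)
    (S : {linear H R -> H R}) (hS : is_antipode Delta S)
    (eta : word) (heta : eta <> [::]) :
  S (coordf R eta) = (-1) ^+ (size eta - 1)%N * Theta' eta (coordf R [::]).
Proof.
pose u w := S (coordf R w) + signed_Theta' R w.
have u0 : u eta = 0.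
  apply: (@mcomp_eq0 _ u (coordf R)) => w.
  rewrite /mcomp; under eq_bigr => v _ do rewrite mulrDl.
  rewrite big_split /= [X in X + _](antipode_mcomp hDelta hS).
  by rewrite [X in _ + X]mcomp_signed_Theta' addNr.
move/eqP: u0; rewrite addr_eq0 => /eqP ->.
by case: eta heta => // i w _; rewrite /signed_Theta' subn1 exprS !mulNr mul1r opprK.
Qed.
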